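(* Let $\mathcal{A}=\left(\frac{-a,-b}{\mathbb{Q}}\right)$ be a rational quaternion division algebra with $a,b>0$, and let $H$ be an order in $\mathcal{A}$ with $\mathbb{Z}$-basis $\{1,v_1,v_2,v_3\}$. Then $H$ is a left principal ideal domain if and only if $\frac{\delta}{p}\in\mathcal{S}_H$ for every positive rational prime $p$ and every nonzero $\delta=d_0+d_1v_1+d_2v_2+d_3v_3$ with $d_0,\dots,d_3\in\mathbb{Z}$, $|d_i|\le \frac{p}{2}$ for all $i$, and $p\mid\mathrm{N}(\delta)$.
   Context: $\mathcal{A}$ has $\mathbb{Q}$-basis $1,i,j,k$ with $i^2=-a$, $j^2=-b$, $k=ij=-ji$, and norm $\mathrm{N}(x_0+x_1i+x_2j+x_3k)=x_0^2+ax_1^2+bx_2^2+abx_3^2$. An order is a subring containing $1$ that is a finitely generated $\mathbb{Z}$-module spanning $\mathcal{A}$ over $\mathbb{Q}$; a left principal ideal domain is one in which every left ideal is of the form $H\gamma$. Define $\mathcal{D}_{\mathcal{A}}=\{\rho\in\mathcal{A}: 0<\mathrm{N}(\rho)<1\}$ and $\mathcal{S}_H=\{\rho\in\mathcal{A}\setminus H:\ \exists\,\alpha,\beta\in H,\ \alpha\rho-\beta\in\mathcal{D}_{\mathcal{A}}\}$. *)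

(* Defs.v *)
From HB Require Import structures.
From mathcomp Require Import all_boot all_order all_algebra.
From mathcomp Require Import classical_sets.
From mathcomp Require Import ring lra.

Set Implicit Arguments.
Unset Strict Implicit.
Unset Printing Implicit Defensive.

Import Order.TTheory GRing.Theory Num.Theory.
Local Open Scope ring_scope.
Local Open Scope classical_set_scope.

(** [quat a b] is the algebra (-a, -b / Q): [Quat x0 x1 x2 x3] stands for
    x0 + x1 i + x2 j + x3 k, with i^2 = -a, j^2 = -b and k = ij = -ji. *)
Record quat (a b : rat) : Type := Quat { q0 : rat; q1 : rat; q2 : rat; q3 : rat }.

Section Quaternions.
Variables a b : rat.
Local Notation Q := (quat a b).
Local Notation mkQ := (@Quat a b).

Definition quat_to (x : Q) := (q0 x, q1 x, q2 x, q3 x).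
Definition quat_of (t : rat * rat * rat * rat) : Q :=
  let: (x0, x1, x2, x3) := t in mkQ x0 x1 x2 x3.

Lemma quat_toK : cancel quat_to quat_of.
Proof. by case. Qed.

HB.instance Definition _ := Choice.copy Q (can_type quat_toK).

Definition addq (x y : Q) : Q :=
  mkQ (q0 x + q0 y) (q1 x + q1 y) (q2 x + q2 y) (q3 x + q3 y).
Definition oppq (x : Q) : Q := mkQ (- q0 x) (- q1 x) (- q2 x) (- q3 x).
Definition scaleq (c : rat) (x : Q) : Q :=
  mkQ (c * q0 x) (c * q1 x) (c * q2 x) (c * q3 x).
Definition mulq (x y : Q) : Q :=
  mkQ (q0 x * q0 y - a * (q1 x * q1 y) - b * (q2 x * q2 y)
         - a * b * (q3 x * q3 y))
      (q0 x * q1 y + q1 x * q0 y + b * (q2 x * q3 y) - b * (q3 x * q2 y))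
      (q0 x * q2 y + q2 x * q0 y - a * (q1 x * q3 y) + a * (q3 x * q1 y))
      (q0 x * q3 y + q3 x * q0 y + q1 x * q2 y - q2 x * q1 y).

Lemma addqA : associative addq.
Proof. by move=> [????] [????] [????]; rewrite /addq /=; congr Quat; ring. Qed.
Lemma addqC : commutative addq.
Proof. by move=> [????] [????]; rewrite /addq /=; congr Quat; ring. Qed.
Lemma add0q : left_id (mkQ 0 0 0 0) addq.
Proof. by move=> [????]; rewrite /addq /=; congr Quat; ring. Qed.
Lemma addNq : left_inverse (mkQ 0 0 0 0) oppq addq.
Proof. by move=> [????]; rewrite /addq /=; congr Quat; ring. Qed.

HB.instance Definition _ := GRing.isZmodule.Build Q addqA addqC add0q addNq.

Lemma mulqA : associative mulq.
Proof. by move=> [????] [????] [????]; rewrite /mulq /=; congr Quat; ring. Qed.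
Lemma mul1q : left_id (mkQ 1 0 0 0) mulq.
Proof. by move=> [????]; rewrite /mulq /=; congr Quat; ring. Qed.
Lemma mulq1 : right_id (mkQ 1 0 0 0) mulq.
Proof. by move=> [????]; rewrite /mulq /=; congr Quat; ring. Qed.
Lemma mulqDl : left_distributive mulq addq.
Proof.
by move=> [????] [????] [????]; rewrite /mulq /addq /=; congr Quat; ring.
Qed.
Lemma mulqDr : right_distributive mulq addq.
Proof.
by move=> [????] [????] [????]; rewrite /mulq /addq /=; congr Quat; ring.
Qed.
Lemma oneq_neq0 : mkQ 1 0 0 0 != 0.
Proof. by apply/eqP => -[]. Qed.

HB.instance Definition _ := GRing.Zmodule_isNzRing.Build Q
  mulqA mul1q mulq1 mulqDl mulqDr oneq_neq0.

Lemma scaleqA (c d : rat) (x : Q) : scaleq c (scaleq d x) = scaleq (c * d) x.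
Proof. by case: x => ????; rewrite /scaleq /=; congr Quat; ring. Qed.
Lemma scale1q : left_id 1 scaleq.
Proof. by move=> [????]; rewrite /scaleq /=; congr Quat; ring. Qed.
Lemma scaleqDr : right_distributive scaleq +%R.
Proof. by move=> c [????] [????]; rewrite /scaleq /=; congr Quat => /=; ring. Qed.
Lemma scaleqDl (x : Q) : {morph scaleq^~ x : c d / c + d}.
Proof.
by case: x => ???? c d; rewrite /scaleq /=; congr Quat => /=; ring.
Qed.

HB.instance Definition _ := GRing.Zmodule_isLmodule.Build rat Q
  scaleqA scale1q scaleqDr scaleqDl.

Lemma scaleqAl (c : rat) (x y : Q) : c *: (x * y) = c *: x * y.
Proof. by case: x y => ???? [????]; congr Quat => /=; ring. Qed.
Lemma scaleqAr (c : rat) (x y : Q) : c *: (x * y) = x * (c *: y).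
Proof. by case: x y => ???? [????]; congr Quat => /=; ring. Qed.

HB.instance Definition _ := GRing.Lmodule_isLalgebra.Build rat Q scaleqAl.
HB.instance Definition _ := GRing.Lalgebra_isAlgebra.Build rat Q scaleqAr.

Definition quat_i : Q := mkQ 0 1 0 0.
Definition quat_j : Q := mkQ 0 0 1 0.
Definition quat_k : Q := mkQ 0 0 0 1.

Lemma quat_ii : quat_i * quat_i = (- a)%:A.
Proof. by congr Quat => /=; ring. Qed.
Lemma quat_jj : quat_j * quat_j = (- b)%:A.
Proof. by congr Quat => /=; ring. Qed.
Lemma quat_ij : quat_i * quat_j = quat_k.
Proof. by congr Quat => /=; ring. Qed.
Lemma quat_ji : quat_j * quat_i = - quat_k.
Proof. by congr Quat => /=; ring. Qed.
Lemma quat_expand (x : Q) :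
  x = (q0 x)%:A + q1 x *: quat_i + q2 x *: quat_j + q3 x *: quat_k.
Proof. by case: x => ????; congr Quat => /=; ring. Qed.

Definition qnorm (x : Q) : rat :=
  q0 x ^+ 2 + a * q1 x ^+ 2 + b * q2 x ^+ 2 + a * b * q3 x ^+ 2.

Definition qconj (x : Q) : Q := mkQ (q0 x) (- q1 x) (- q2 x) (- q3 x).

Lemma mulq_conj (x : Q) : x * qconj x = (qnorm x)%:A.
Proof. by case: x => ????; rewrite /qnorm; congr Quat => /=; ring. Qed.
Lemma mul_conjq (x : Q) : qconj x * x = (qnorm x)%:A.
Proof. by case: x => ????; rewrite /qnorm; congr Quat => /=; ring. Qed.
Lemma qnormM (x y : Q) : qnorm (x * y) = qnorm x * qnorm y.
Proof. by case: x y => ???? [????]; rewrite /qnorm /=; ring. Qed.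

End Quaternions.

Definition is_division_ring (R : nzRingType) : Prop :=
  forall x : R, x != 0 -> exists y : R, x * y = 1 /\ y * x = 1.

Lemma quat_division (a b : rat) :
  0 < a -> 0 < b -> is_division_ring (quat a b).
Proof.
move=> a0 b0 x xN0.
have Nx : qnorm x != 0.
  apply: contraNneq xN0; case: x => x0 x1 x2 x3; rewrite /qnorm /= => N0.
  have s0 := sqr_ge0 x0.
  have s1 := mulr_ge0 (ltW a0) (sqr_ge0 x1).
  have s2 := mulr_ge0 (ltW b0) (sqr_ge0 x2).
  have s3 := mulr_ge0 (ltW (mulr_gt0 a0 b0)) (sqr_ge0 x3).
  have /eqP e0 : x0 ^+ 2 == 0 by apply/eqP; lra.
  have /eqP e1 : a * x1 ^+ 2 == 0 by apply/eqP; lra.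
  have /eqP e2 : b * x2 ^+ 2 == 0 by apply/eqP; lra.
  have /eqP e3 : a * b * x3 ^+ 2 == 0 by apply/eqP; lra.
  move/eqP: e0; move/eqP: e1; move/eqP: e2; move/eqP: e3.
  rewrite !mulf_eq0 (gt_eqF a0) (gt_eqF b0) /= !orbb.
  by move=> /eqP-> /eqP-> /eqP-> /eqP->.
exists ((qnorm x)^-1 *: qconj x).
by rewrite -scalerAr -scalerAl mulq_conj mul_conjq scalerA mulVf // scale1r.
Qed.

Section Orders.
Variables a b : rat.
Local Notation Q := (quat a b).

Definition fin_gen_Zmod (H : set Q) : Prop :=
  exists (n : nat) (g : n.-tuple Q), H = [set x | inIntSpan g x].

Definition spans_over_rat (H : set Q) : Prop :=
  forall x : Q, exists (n : nat) (h : 'I_n -> Q) (c : 'I_n -> rat),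
    (forall i, H (h i)) /\ x = \sum_(i < n) c i *: h i.

Definition is_order (H : set Q) : Prop :=
  [/\ subring_closed (mem H), fin_gen_Zmod H & spans_over_rat H].

Definition is_Zbasis (n : nat) (v : n.-tuple Q) (H : set Q) : Prop :=
  H = [set x | inIntSpan v x] /\
  forall c : 'I_n -> int,
    \sum_(i < n) tnth v i *~ c i = 0 -> forall i, c i = 0.

Definition left_ideal (H I : set Q) : Prop :=
  [/\ I `<=` H, zmod_closed (mem I) &
      forall h x, H h -> I x -> I (h * x)].

Definition left_PID (H : set Q) : Prop :=
  (forall x y, H x -> H y -> x * y = 0 -> x = 0 \/ y = 0) /\
  forall I : set Q, left_ideal H I ->
    exists2 g, H g & I = [set h * g | h in H].

Definition D_A : set Q := [set rho | 0 < qnorm rho < 1].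

Definition S_set (H : set Q) : set Q :=
  [set rho | ~ H rho /\
     exists alpha beta, [/\ H alpha, H beta & D_A (alpha * rho - beta)]].

End Orders.

(* Main.v *)
(** As in the Dedekind-Hasse criterion, [H] is a left PID iff every [rho] outside
    [H] lies in [S_H]: a generator of [H n + H (n rho)] divided by [n] has norm
    [< 1], and conversely a nonzero element of minimal norm generates a left
    ideal.  Norms on [H] are integers since those of all powers of an element
    have a common denominator.  An integer multiple of [rho] has the form
    [tau / p] outside [H], with [p] prime and [tau] in [H].  If [p] does not
    divide [N tau], left multiplication by the conjugate of [tau] gives the
    non-integer [N tau / p]; otherwise reducing [tau] modulo [p H] yields one of
    the [delta] of the theorem. *)

Require Import Defs.
From HB Require Import structures.
From mathcomp Require Import all_boot all_order all_algebra.
From mathcomp Require Import boolp classical_sets.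
From mathcomp Require Import zify ring lra.

Set Implicit Arguments.
Unset Strict Implicit.
Unset Printing Implicit Defensive.

Import Order.TTheory GRing.Theory Num.Theory.
Local Open Scope ring_scope.
Local Open Scope classical_set_scope.

(** * Integrality and denominators in the rationals *)

Lemma rat_int_of_bounded_denominators (D q : rat) :
  D != 0 -> (forall n, D * q ^+ n \is a Num.int) -> q \is a Num.int.
Proof.
move=> D0 DqZ; have := DqZ 0%N; rewrite expr0 mulr1 => /intrP[z Dz].
have z0 : (0 < `|z|)%N by rewrite absz_gt0 -(intr_eq0 rat) -Dz.
(* The exponent [|z|] suffices: by coprimality [denq q ^ |z|] divides [z], but [k ^ |z|] exceeds
   [|z|] as soon as [k > 1]. *)
have /intrP[m Em] := DqZ `|z|%N.
have d0 : (denq q)%:~R != 0 :> rat by rewrite intr_eq0 denq_neq0.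
have : z * numq q ^+ `|z| = m * denq q ^+ `|z|.
  apply: (@intr_inj rat); rewrite !rmorphM !rmorphXn /= -Em Dz numqE exprMn.
  by rewrite mulrA.
move/(congr1 absz); rewrite !abszM !abszX => E.
have : (`|denq q| ^ `|z| %| `|z|)%N.
  rewrite -(@Gauss_dvdl _ _ (`|numq q| ^ `|z|)) ?E ?dvdn_mull //.
  by rewrite coprimeXl // coprimeXr // coprime_sym coprime_num_den.
move/(dvdn_leq z0) => le; rewrite Qint_def -absz_denq eqz_nat eqn_leq.
rewrite absz_gt0 denq_neq0 andbT leqNgt; apply/negP => /(ltn_expl `|z|%N).
by rewrite ltnNge le.
Qed.

Lemma common_denominator (s : seq rat) :
  exists2 M : int, M != 0 & {in s, forall q, M%:~R * q \is a Num.int}.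
Proof.
elim: s => [|q s [M M0 Ms]]; first by exists 1.
exists (M * denq q); first by rewrite mulf_neq0 ?denq_neq0.
move=> r; rewrite inE intrM => /orP[/eqP->|/Ms rM].
  by rewrite -mulrA [X in _ * X]mulrC -numqE rpredM ?intr_int.
by rewrite mulrAC rpredM ?intr_int.
Qed.

(** * Norm and conjugation *)

Lemma scale_nat_quat (a b : rat) (n : nat) (x : quat a b) :
  n%:R *: x = n%:R * x.
Proof. by rewrite scaler_nat mulr_natl. Qed.

Lemma intr_quat (a b : rat) (n : int) : n%:~R = n%:~R%:A :> quat a b.
Proof. by rewrite scaler_int. Qed.

Lemma qnormZ (a b c : rat) (x : quat a b) : qnorm (c *: x) = c ^+ 2 * qnorm x.
Proof. by case: x => *; rewrite /qnorm /=; ring. Qed.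

Lemma qnorm_alg (a b c : rat) : qnorm (c%:A : quat a b) = c ^+ 2.
Proof. by rewrite qnormZ /qnorm /=; ring. Qed.

Lemma qnorm1 (a b : rat) : qnorm (1 : quat a b) = 1.
Proof. by rewrite -[1]scale1r qnorm_alg expr1n. Qed.

Lemma qnorm_ge0 (a b : rat) (x : quat a b) :
  0 < a -> 0 < b -> 0 <= qnorm x.
Proof.
move=> /ltW a0 /ltW b0.
by rewrite !addr_ge0 ?sqr_ge0 // mulr_ge0 ?sqr_ge0 // mulr_ge0.
Qed.

(** An inverse [y] of a nonzero [x] gives [qnorm x * qnorm y = 1]. *)
Lemma qnorm_gt0 (a b : rat) (x : quat a b) :
  0 < a -> 0 < b -> (0 < qnorm x) = (x != 0).
Proof.
move=> a0 b0; rewrite lt0r qnorm_ge0 // andbT.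
have [->|/quat_division-/(_ a0 b0)[y [xy _]]] := eqVneq x 0.
  by rewrite -[0 : quat a b](scale0r 0) qnormZ expr0n mul0r eqxx.
apply/eqP => Nx0; have := congr1 (@qnorm a b) xy.
by rewrite qnormM Nx0 mul0r qnorm1.
Qed.

Lemma quat_mul_eq0 (a b : rat) (x y : quat a b) :
  0 < a -> 0 < b -> x * y = 0 -> x = 0 \/ y = 0.
Proof.
move=> a0 b0 xy0; case: (eqVneq x 0) => [|x0]; [by left | right].
have [z [_ zx]] := quat_division a0 b0 x0.
by rewrite -[y]mul1r -zx -mulrA xy0 mulr0.
Qed.

(** The scalar is the trace of [x], written with norms only, so integrality of norms on an order
    yields stability under conjugation. *)
Lemma qconjE (a b : rat) (x : quat a b) :
  qconj x = (qnorm (1 + x) - qnorm x - 1)%:A - x.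
Proof. by case: x => *; congr Quat; rewrite /qnorm /=; ring. Qed.

(* The middle coefficient is the polar form of the norm, hence an integer on an
   order. *)
Lemma qnorm_subM (a b c : rat) (x y : quat a b) :
  qnorm (x - c *: y) =
  qnorm x - c * (qnorm (x + y) - qnorm x - qnorm y) + c ^+ 2 * qnorm y.
Proof. by case: x y => ???? [????]; rewrite /qnorm /=; ring. Qed.

(** * Closure properties of orders and coordinates in a basis *)

Lemma order1 (a b : rat) (H : set (quat a b)) : is_order H -> H 1.
Proof. by case=> -[H1 _ _] _ _; rewrite -in_setE. Qed.

Lemma orderB (a b : rat) (H : set (quat a b)) (x y : quat a b) :
  is_order H -> H x -> H y -> H (x - y).
Proof.
case=> -[_ HB _] _ _ /mem_set Hx /mem_set Hy.
exact/set_mem/(HB x y Hx Hy).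
Qed.

Lemma orderM (a b : rat) (H : set (quat a b)) (x y : quat a b) :
  is_order H -> H x -> H y -> H (x * y).
Proof.
case=> -[_ _ HM] _ _ /mem_set Hx /mem_set Hy.
exact/set_mem/(HM x y Hx Hy).
Qed.

Lemma order0 (a b : rat) (H : set (quat a b)) : is_order H -> H 0.
Proof.
by move=> hH; rewrite -(subrr 1); apply: orderB => //; exact: order1.
Qed.

Lemma orderN (a b : rat) (H : set (quat a b)) (x : quat a b) :
  is_order H -> H x -> H (- x).
Proof. by move=> hH Hx; rewrite -sub0r; apply: orderB => //; exact: order0. Qed.

Lemma orderD (a b : rat) (H : set (quat a b)) (x y : quat a b) :
  is_order H -> H x -> H y -> H (x + y).
Proof.
by move=> hH Hx Hy; rewrite -[y]opprK; apply: orderB => //; exact: orderN.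
Qed.

Lemma orderX (a b : rat) (H : set (quat a b)) (x : quat a b) (n : nat) :
  is_order H -> H x -> H (x ^+ n).
Proof.
move=> hH Hx; elim: n => [|n IHn]; first by rewrite expr0; exact: order1.
by rewrite exprS; exact: orderM.
Qed.

Lemma order_nat (a b : rat) (H : set (quat a b)) (n : nat) :
  is_order H -> H n%:R.
Proof.
move=> hH; elim: n => [|n IHn]; first exact: order0.
by rewrite -addn1 natrD; apply: orderD => //; exact: order1.
Qed.

Lemma order_int (a b : rat) (H : set (quat a b)) (n : int) :
  is_order H -> H n%:~R.
Proof.
move=> hH; case: n => n; first exact: order_nat.
by rewrite NegzE mulrNz; apply: orderN => //; exact: order_nat.
Qed.

(** Denominators are cleared term by term in a rational combination of elements of [H]; adding two
    terms multiplies their multipliers. *)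
Lemma order_torsion (a b : rat) (H : set (quat a b)) (x : quat a b) :
  is_order H -> exists2 n : nat, (0 < n)%N & H (n%:R *: x).
Proof.
move=> hH; have [_ _ /(_ x)[m [h [c [Hh ->]]]]] := hH.
elim/big_ind: _ => [|y z [k k0 Hy] [l l0 Hz]|i _].
- by exists 1%N => //; rewrite scaler0; exact: order0.
- exists (k * l)%N; first by rewrite muln_gt0 k0.
  rewrite scalerDr {1}mulnC !natrM -!scalerA.
  by apply: orderD => //; rewrite scale_nat_quat; apply: orderM => //;
    exact: order_nat.
- exists `|denq (c i)|%N; first by rewrite absz_gt0 denq_neq0.
  rewrite pmulrn absz_denq scalerA mulrC -numqE scaler_int -mulrzl.
  by apply: orderM => //; exact: order_int.
Qed.

Lemma Zbasis4P (a b : rat) (H : set (quat a b)) (v1 v2 v3 x : quat a b) :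
  is_Zbasis [tuple 1; v1; v2; v3] H ->
  H x <-> exists d0 d1 d2 d3 : int,
    x = d0%:~R + v1 *~ d1 + v2 *~ d2 + v3 *~ d3.
Proof.
case=> -> _; split=> [[c ->]|[d0 [d1 [d2 [d3 ->]]]]].
  rewrite !big_ord_recr big_ord0 /= add0r.
  by do 4!eexists.
exists [ffun i : 'I_4 => [:: d0; d1; d2; d3]`_i].
by rewrite !big_ord_recr big_ord0 /= add0r !ffunE.
Qed.

Lemma Zbasis4_inj (a b : rat) (H : set (quat a b)) (v1 v2 v3 : quat a b)
    (d0 d1 d2 d3 : int) :
  is_Zbasis [tuple 1; v1; v2; v3] H ->
  d0%:~R + v1 *~ d1 + v2 *~ d2 + v3 *~ d3 = 0 ->
  [/\ d0 = 0, d1 = 0, d2 = 0 & d3 = 0].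
Proof.
case=> _ inj E0; have := inj (fun i : 'I_4 => [:: d0; d1; d2; d3]`_i).
rewrite !big_ord_recr big_ord0 /= add0r => /(_ E0) d_eq0.
by split; [have := d_eq0 (inord 0) | have := d_eq0 (inord 1)
  | have := d_eq0 (inord 2) | have := d_eq0 (inord 3)]; rewrite /= inordK.
Qed.

(** Used both to reduce coordinates modulo [p] and to compare those of [delta] with [p] times those
    of an element of [H]. *)
Lemma Zcomb4B (a b : rat) (v1 v2 v3 : quat a b) (n : nat)
    (d0 d1 d2 d3 e0 e1 e2 e3 : int) :
  (d0 - n%:Z * e0)%:~R + v1 *~ (d1 - n%:Z * e1) + v2 *~ (d2 - n%:Z * e2)
    + v3 *~ (d3 - n%:Z * e3) =
  d0%:~R + v1 *~ d1 + v2 *~ d2 + v3 *~ d3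
    - n%:R *: (e0%:~R + v1 *~ e1 + v2 *~ e2 + v3 *~ e3).
Proof.
rewrite !intr_quat -!scaler_int !rmorphB !rmorphM /=.
by case: v1 v2 v3 => ???? [????] [????]; congr Quat => /=; ring.
Qed.

(** * Integrality of the norm and the conjugate *)

(** If [M] clears the coordinates of the basis and [K] the coefficients of the norm form,
    [K * M ^ 2] clears all norms. *)
Lemma order_norm_bounded_denominator (a b : rat) (H : set (quat a b))
    (v1 v2 v3 : quat a b) :
  is_Zbasis [tuple 1; v1; v2; v3] H ->
  exists2 D : rat, D != 0 & forall x, H x -> D * qnorm x \is a Num.int.
Proof.
move=> hv; pose co (x : quat a b) := [:: q0 x; q1 x; q2 x; q3 x].
have [M M0 MZ] := common_denominator 
  (co 1 ++ co v1 ++ co v2 ++ co v3).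
have [K K0 KZ] := common_denominator [:: a; b; a * b].
have MH x : H x -> {in co x, forall q, M%:~R * q \is a Num.int}.
  move/(Zbasis4P x hv) => [d0 [d1 [d2 [d3 ->]]]] q.
  have MZd (d : int) (r : rat) : M%:~R * r \is a Num.int ->
      M%:~R * (d%:~R * r) \is a Num.int.
    by move=> MrZ; rewrite mulrCA rpredM ?intr_int.
  rewrite intr_quat -!scaler_int !inE => /or4P[] /eqP-> /=;
    by rewrite !mulrDr !rpredD // MZd // MZ // !(mem_cat, inE) eqxx ?orbT.
exists (K%:~R * M%:~R ^+ 2); first by rewrite mulf_neq0 ?expf_neq0 ?intr_eq0.
move=> x /MH MZx.
have -> : K%:~R * M%:~R ^+ 2 * qnorm x =
    K%:~R * (M%:~R * q0 x) ^+ 2 + (K%:~R * a) * (M%:~R * q1 x) ^+ 2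
    + (K%:~R * b) * (M%:~R * q2 x) ^+ 2
    + (K%:~R * (a * b)) * (M%:~R * q3 x) ^+ 2.
  by rewrite /qnorm; ring.
by rewrite !rpredD // rpredM ?rpredX ?intr_int ?KZ ?MZx // !inE eqxx ?orbT.
Qed.

(* The powers of [x] stay in [H], so their norms [qnorm x ^+ n] have a common
   denominator. *)
Lemma order_norm_int (a b : rat) (H : set (quat a b)) (v1 v2 v3 x : quat a b) :
  is_order H -> is_Zbasis [tuple 1; v1; v2; v3] H -> H x ->
  qnorm x \is a Num.int.
Proof.
move=> hH hv Hx; have [D D0 DZ] := order_norm_bounded_denominator hv.
apply: (@rat_int_of_bounded_denominators D) => // n.
suff <- : qnorm (x ^+ n) = qnorm x ^+ n by apply: DZ; exact: orderX.
elim: n => [|n IHn]; first by rewrite !expr0 qnorm1.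
by rewrite !exprS qnormM IHn.
Qed.

Lemma order_conj (a b : rat) (H : set (quat a b)) (v1 v2 v3 x : quat a b) :
  is_order H -> is_Zbasis [tuple 1; v1; v2; v3] H -> H x -> H (qconj x).
Proof.
move=> hH hv Hx; rewrite qconjE; apply: orderB => //.
have NZ := order_norm_int hH hv; have H1x := orderD hH (order1 hH) Hx.
have /intrP[n ->] : qnorm (1 + x) - qnorm x - 1 \is a Num.int.
  by rewrite !rpredB ?rpred1 ?NZ.
by rewrite -intr_quat; exact: order_int.
Qed.

(** * The Dedekind-Hasse criterion *)

(** The left factor [x] is absorbed into [alpha]. *)
Lemma S_setM (a b : rat) (H : set (quat a b)) (x rho : quat a b) :
  is_order H -> H x -> ~ H rho -> S_set H (x * rho) -> S_set H rho.
Proof.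
move=> hH Hx rhoH [_ [y [z [Hy Hz Dyz]]]]; split=> //.
by exists (y * x), z; split=> //; [exact: orderM | rewrite -mulrA].
Qed.

(** The translation is absorbed into [beta], so [rho] may be changed modulo [H]. *)
Lemma S_setB (a b : rat) (H : set (quat a b)) (eta rho : quat a b) :
  is_order H -> H eta -> S_set H (rho - eta) -> S_set H rho.
Proof.
move=> hH Heta [rhoH [x [y [Hx Hy Dxy]]]]; split.
  by move=> Hrho; apply: rhoH; exact: orderB.
exists x, (x * eta + y); split=> //.
  by apply: orderD => //; exact: orderM.
by rewrite opprD addrA -mulrBr.
Qed.

(* If [H n + H (n rho) = H g] and [n = h g], then [w = g / n] inverts [h], so
   [N w = 1 / N h]; and [N h = 1] would make [rho] a multiple of [w = qconj h]. *)
Lemma left_PID_S_set (a b : rat) (H : set (quat a b))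
    (v1 v2 v3 rho : quat a b) :
  0 < a -> 0 < b -> is_order H -> is_Zbasis [tuple 1; v1; v2; v3] H ->
  left_PID H -> ~ H rho -> S_set H rho.
Proof.
move=> a0 b0 hH hv [_ pid] rhoH; split=> //.
have [n n0 Hnrho] := order_torsion rho hH.
(* The difference mirrors [alpha * rho - beta]: the coefficients of a generator serve as [alpha] and
   [beta]. *)
pose I := [set y | exists x z,
  [/\ H x, H z & y = x * (n%:R *: rho) - z * n%:R]].
have II : left_ideal H I.
  split.
  - move=> _ [x [z [Hx Hz ->]]].
    by apply: orderB => //; apply: orderM => //; exact: order_nat.
  - split.
      apply: mem_set; exists 0, 0; rewrite !mul0r subrr.
      by split=> //; exact: order0.
    move=> x y /set_mem[x1 [x2 [Hx1 Hx2 ->]]] /set_mem[y1 [y2 [Hy1 Hy2 ->]]].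
    apply: mem_set; exists (x1 - y1), (x2 - y2).
    split; [exact: orderB | exact: orderB |].
    by rewrite !mulrBl !opprB addrACA [RHS]addrACA [- _ - _]addrC.
  - move=> h _ Hh [x [z [Hx Hz ->]]]; exists (h * x), (h * z).
    by split; [exact: orderM | exact: orderM | rewrite mulrBr !mulrA].
have [g Hg Ig] := pid I II.
have In : I n%:R.
  exists 0, (-1); rewrite mul0r sub0r mulNr mul1r opprK.
  by split=> //; [exact: order0 | apply: orderN => //; exact: order1].
have Inrho : I (n%:R *: rho).
  exists 1, 0; rewrite mul1r mul0r subr0.
  by split=> //; [exact: order1 | exact: order0].
have [x [z [Hx Hz gE]]] : I g.
  by rewrite Ig; exists 1; rewrite ?mul1r //; exact: order1.
move: In Inrho; rewrite Ig => -[h Hh hg] [h' Hh' h'g].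
have nN0 : n%:R != 0 :> rat by rewrite pnatr_eq0 -lt0n.
exists x, z; split=> //; set w := x * rho - z.
have gw : g = n%:R *: w by rewrite gE mulr_natr -scaler_nat -scalerAr -scalerBr.
have hw : h * w = 1.
  by apply: (scalerI nN0); rewrite scalerAr -gw hg scaler_nat.
have rhoE : rho = h' * w by apply: (scalerI nN0); rewrite scalerAr -gw h'g.
have NhNw : qnorm h * qnorm w = 1 by rewrite -qnormM hw qnorm1.
have /intrP[m Nh] := order_norm_int hH hv Hh.
have Nh0 := qnorm_ge0 h a0 b0.
have Nw0 : 0 < qnorm w.
  rewrite lt0r qnorm_ge0 // andbT; apply: contra_eqN NhNw => /eqP->.
  by rewrite mulr0 eq_sym oner_eq0.
have m0 : 0 < m by rewrite -(ltr0z rat) -Nh -(pmulr_lgt0 _ Nw0) NhNw.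
rewrite /D_A /= Nw0 /=.
have [m1|m1] := eqVneq m 1.
  case: rhoH; rewrite rhoE; apply: orderM => //.
  suff -> : w = qconj h by exact: (order_conj hH hv).
  rewrite -[RHS]mulr1 -hw mulrA mul_conjq Nh m1.
  by rewrite scale1r mul1r.
have : 2 <= qnorm h by rewrite Nh (ler_int rat 2); lia.
nra.
Qed.

(** Let [g] have minimal norm among the nonzero elements of [I]. If [y / g] were outside [H] for
    some [y] in [I], then [r * (y / g) - s] would have norm strictly between 0 and 1 for some [r],
    [s] in [H], and [r * y - s * g] would be a nonzero element of [I] of smaller norm. *)
Lemma S_set_left_PID (a b : rat) (H : set (quat a b)) (v1 v2 v3 : quat a b) :
  0 < a -> 0 < b -> is_order H -> is_Zbasis [tuple 1; v1; v2; v3] H ->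
  (forall rho, ~ H rho -> S_set H rho) -> left_PID H.
Proof.
move=> a0 b0 hH hv SH; split=> [x y _ _|I [IH [I0 IB] IM]].
  exact: quat_mul_eq0.
have [[x Ix x0]|I00] := pselect (exists2 x, I x & x != 0); last first.
  exists 0; first exact: order0.
  apply/seteqP; split=> [x Ix|_ [h _ <-]].
    exists 0; rewrite ?mulr0; first exact: order0.
    by apply: contrapT => /eqP; rewrite eq_sym => x0; apply: I00; exists x.
  by rewrite mulr0; exact: set_mem.
pose P n := `[< exists x, [/\ I x, x != 0 & qnorm x = n%:R] >].
have exP : exists n, P n.
  have /intrP[[] m Nx] := order_norm_int hH hv (IH _ Ix).
    by exists m; apply/asboolP; exists x.
  by have := qnorm_ge0 x a0 b0; rewrite Nx ler0z.
have [n] := ex_minnP exP; move=> /asboolP[g [Ig g0 Ng]] nmin.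
exists g; first exact: IH.
apply/seteqP; split=> [y Iy|_ [h Hh <-]]; last exact: IM.
have [g' [_ g'g]] := quat_division a0 b0 g0.
have [Hyg|/SH[_ [r [s [Hr Hs /= /andP[D0 D1]]]]]] := pselect (H (y * g')).
  by exists (y * g') => //; rewrite -mulrA g'g mulr1.
pose z := (r * (y * g') - s) * g.
have Iz : I z.
  rewrite /z mulrBl -!mulrA g'g mulr1; apply: set_mem.
  by apply: IB; apply: mem_set; exact: IM.
have Nz : qnorm z = qnorm (r * (y * g') - s) * n%:R by rewrite qnormM Ng.
have n0 : 0 < n%:R :> rat by rewrite -Ng qnorm_gt0.
have z0 : z != 0 by rewrite -(qnorm_gt0 _ a0 b0) Nz mulr_gt0.
have /intrP[m Ezm] := order_norm_int hH hv (IH _ Iz).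
case: m Ezm => m Ezm; last by have := qnorm_ge0 z a0 b0; rewrite Ezm ler0z.
have /nmin : P m by apply/asboolP; exists z.
by rewrite leqNgt -(ltr_nat rat) -[m%:R]Ezm Nz gtr_pMl // D1.
Qed.

(** * Reduction to prime denominators and centred coordinates *)

Lemma centered_residue (p : nat) (d : int) :
  (0 < p)%N -> exists e : int, `|(d - p%:Z * e)%:~R| <= p%:R / 2 :> rat.
Proof.
move=> p0; have pQ : 0 < p%:R :> rat by rewrite ltr0n.
(* Adding 1/2 before taking the floor rounds [d / p] to a nearest integer. *)
exists (Num.floor (d%:~R / p%:R + 1 / 2 : rat)).
set e := Num.floor _; have /andP[] := floor_itv (d%:~R / p%:R + 1 / 2 : rat).
rewrite -/e; set q := d%:~R / p%:R => eq qe.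
have -> : (d - p%:Z * e)%:~R = p%:R * (q - e%:~R) :> rat.
  by rewrite rmorphB rmorphM /= mulrBr /q [X in _ = X - _]mulrC divfK ?gt_eqF.
rewrite normrM gtr0_norm // ler_pM2l // ler_norml.
by move: qe; rewrite rmorphD /= => qe; apply/andP; split; lra.
Qed.

Lemma S_set_prime_denominator (a b : rat) (H : set (quat a b))
    (v1 v2 v3 tau : quat a b) (p : nat) :
  is_order H -> is_Zbasis [tuple 1; v1; v2; v3] H ->
  (forall (q : nat) (d0 d1 d2 d3 : int),
     let delta : quat a b := d0%:~R + v1 *~ d1 + v2 *~ d2 + v3 *~ d3 in
     prime q -> delta != 0 ->
     (forall d : int, d \in [:: d0; d1; d2; d3] ->
        `|d%:~R| <= q%:R / 2 :> rat) ->
     (exists m : int, qnorm delta = q%:R * m%:~R) ->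
     S_set H ((q%:R : rat)^-1 *: delta)) ->
  prime p -> H tau -> ~ H ((p%:R : rat)^-1 *: tau) ->
  S_set H ((p%:R : rat)^-1 *: tau).
Proof.
move=> hH hv Sp pp Htau tauH; have p0 := prime_gt0 pp.
have pN0 : p%:R != 0 :> rat by rewrite pnatr_eq0 -lt0n.
have NZ := order_norm_int hH hv.
have /intrP[N EN] := NZ tau Htau.
have [/dvdzP[m Nm]|pN] := boolP (p%:Z %| N)%Z; last first.
  (* [qconj tau * tau / p = N / p] is not an integer: its fractional part works. *)
  split=> //; exists (qconj tau), (N %/ p%:Z)%Z%:~R.
  split; [exact: (order_conj hH hv) | exact: order_int |].
  rewrite /D_A /= -scalerAr mul_conjq EN scalerA intr_quat -scalerBl qnorm_alg.
  have p0Z : p%:Z != 0 by rewrite eqz_nat -lt0n.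
  have r0 : (0 : rat) < (N %% p%:Z)%Z%:~R.
    rewrite ltr0z lt0r modz_ge0 // andbT; apply: contraNneq pN => N0.
    exact/dvdz_mod0P.
  have rp : (N %% p%:Z)%Z%:~R < p%:R :> rat.
    by rewrite (ltr_int rat _ p%:Z) ltz_pmod // ltz_nat.
  set u := _ - _; have -> : u = (N %% p%:Z)%Z%:~R / p%:R.
    by rewrite /u {1}(divz_eq N p%:Z) rmorphD rmorphM /=; field.
  have pQ := lt_trans r0 rp.
  rewrite exprn_gt0 ?divr_gt0 //=.
  by rewrite exprn_ilt1 ?divr_ge0 ?ltW // ltr_pdivrMr ?mul1r.
(* Here [p] divides the norm of [tau]; centring the coordinates subtracts some [p *: eta], which
   changes [tau / p] only by [eta]. *)
have [d0 [d1 [d2 [d3 tauE]]]] := (Zbasis4P tau hv).1 Htau.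
have [e0 r0] := centered_residue d0 p0; have [e1 r1] := centered_residue d1 p0.
have [e2 r2] := centered_residue d2 p0; have [e3 r3] := centered_residue d3 p0.
pose eta := e0%:~R + v1 *~ e1 + v2 *~ e2 + v3 *~ e3.
have Heta : H eta by apply/(Zbasis4P eta hv); exists e0, e1, e2, e3.
have deltaE : (d0 - p%:Z * e0)%:~R + v1 *~ (d1 - p%:Z * e1)
    + v2 *~ (d2 - p%:Z * e2) + v3 *~ (d3 - p%:Z * e3) = tau - p%:R *: eta.
  by rewrite Zcomb4B -tauE.
have subE : (p%:R : rat)^-1 *: (tau - p%:R *: eta) = p%:R^-1 *: tau - eta.
  by rewrite scalerBr scalerA mulVf // scale1r.
apply: (S_setB hH Heta); rewrite -subE -deltaE; apply: Sp => //.
- rewrite deltaE subr_eq0; apply: contra_notN tauH => /eqP->.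
  by rewrite scalerA mulVf // scale1r.
- by move=> d; rewrite !inE => /or4P[] /eqP->.
have /intrP[t Et] : qnorm (tau + eta) - qnorm tau - qnorm eta \is a Num.int.
  by rewrite !rpredB ?NZ //; exact: orderD.
have /intrP[s Es] := NZ eta Heta.
(* The expansion is [N(tau - p eta) = m p - p t + p^2 s], with [t] the polar form at [tau], [eta]
   and [s] the norm of [eta]. *)
exists (m - t + p%:Z * s); rewrite deltaE qnorm_subM Et Es EN Nm.
by rewrite !(rmorphD, rmorphM, rmorphN) /=; ring.
Qed.

(** Strong induction on [n] with [n rho] in [H]: for a prime factor [p] of [n] and [m = n / p],
    either [m rho] lies in [H] and [m] replaces [n], or [m rho = (n rho) / p] has a prime
    denominator and [S_setM] passes back to [rho]. *)
Lemma S_set_of_prime_denominators (a b : rat) (H : set (quat a b))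
    (rho : quat a b) :
  is_order H ->
  (forall (p : nat) (tau : quat a b), prime p -> H tau ->
     ~ H ((p%:R : rat)^-1 *: tau) -> S_set H ((p%:R : rat)^-1 *: tau)) ->
  ~ H rho -> S_set H rho.
Proof.
move=> hH Sp rhoH; have [n] := order_torsion rho hH.
elim/ltn_ind: n => n IHn n0 Hn.
have [n1|n1] := leqP n 1.
  by case: rhoH; rewrite -[rho]scale1r -[1]/(1%:R) -(_ : n = 1%N) //; lia.
have pp := pdiv_prime n1; have p0 := prime_gt0 pp.
have nE := divnK (pdiv_dvd n); set m := (n %/ pdiv n)%N in nE.
have m0 : (0 < m)%N by rewrite divn_gt0 // pdiv_leq.
have [Hm|mH] := pselect (H (m%:R *: rho)).
  by apply: (IHn m) => //; rewrite -nE ltn_Pmulr // prime_gt1.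
apply: (@S_setM _ _ _ m%:R) => //; first exact: order_nat.
have mE : m%:R *: rho = (pdiv n)%:R^-1 *: (n%:R *: rho).
  by rewrite scalerA -{2}nE natrM mulrCA mulVf ?mulr1 // pnatr_eq0 -lt0n.
by rewrite -scale_nat_quat mE; apply: Sp; rewrite -?mE.
Qed.

Theorem theorem4p3 (a b : rat) (ha : 0 < a) (hb : 0 < b)
    (hA : is_division_ring (quat a b))
    (H : set (quat a b)) (v1 v2 v3 : quat a b)
    (hH : is_order H) (hv : is_Zbasis [tuple 1; v1; v2; v3] H) :
  left_PID H <->
  (forall (p : nat) (d0 d1 d2 d3 : int),
     let delta : quat a b := d0%:~R + v1 *~ d1 + v2 *~ d2 + v3 *~ d3 in
     prime p ->
     delta != 0 ->
     (forall d : int, d \in [:: d0; d1; d2; d3] ->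
        `|d%:~R| <= p%:R / 2 :> rat) ->
     (exists m : int, qnorm delta = p%:R * m%:~R) ->
     S_set H ((p%:R : rat)^-1 *: delta)).
Proof.
split=> [pid p d0 d1 d2 d3 delta pp delta0 hd _|Sp]; last first.
  apply: (S_set_left_PID ha hb hH hv) => rho.
  apply: S_set_of_prime_denominators => // p tau.
  exact: (S_set_prime_denominator hH hv Sp).
(* If [delta / p] were in [H], each [d_i] would be a multiple of [p]; the bound [p / 2] would then
   make all of them vanish, against [delta != 0]. *)
apply: (left_PID_S_set ha hb hH hv) => // Hdelta.
have p0 : 0 < p%:R :> rat by rewrite ltr0n prime_gt0.
have [e0 [e1 [e2 [e3 eE]]]] := (Zbasis4P _ hv).1 Hdelta.
have small d e : d \in [:: d0; d1; d2; d3] -> d = p%:Z * e -> d = 0.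
  move=> /hd + dE; rewrite dE rmorphM /= normrM gtr0_norm // ler_pM2l //.
  rewrite -intr_norm => le2.
  have lt1 : `|e| < 1 by rewrite -(ltr_int rat); lra.
  by rewrite (_ : e = 0) ?mulr0 //; lia.
have E0 : (d0 - p%:Z * e0)%:~R + v1 *~ (d1 - p%:Z * e1)
    + v2 *~ (d2 - p%:Z * e2) + v3 *~ (d3 - p%:Z * e3) = 0.
  by rewrite Zcomb4B -eE -/delta scalerA divff ?gt_eqF // scale1r subrr.
have [/subr0_eq E00 /subr0_eq E1 /subr0_eq E2 /subr0_eq E3] :=
  Zbasis4_inj hv E0.
have d0_0 : d0 = 0 by apply: (small d0 e0); rewrite // !inE eqxx.
have d1_0 : d1 = 0 by apply: (small d1 e1); rewrite // !inE eqxx ?orbT.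
have d2_0 : d2 = 0 by apply: (small d2 e2); rewrite // !inE eqxx ?orbT.
have d3_0 : d3 = 0 by apply: (small d3 e3); rewrite // !inE eqxx ?orbT.
by move: delta0; rewrite /delta d0_0 d1_0 d2_0 d3_0 !mulr0z !addr0 eqxx.
Qed.
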